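(* Let $d\in\mathbb N$. The algebra $M_6(\mathcal M_d)$, acting on $(H^2_d)^{\oplus 6}=H^2_d\otimes\mathbb C^6$, does not have property $\mathbb A_1(1)$.
   Context: For $d\in\mathbb N$, $H^2_d$ is the Drury-Arveson space, the reproducing kernel Hilbert space of analytic functions on the unit ball $\mathbb B_d\subset\mathbb C^d$ with kernel $\frac1{1-\langle z,w\rangle}$; $\mathcal M_d\subset B(H^2_d)$ is its multiplier algebra (for $d=1$ these are $H^2(\mathbb D)$ and $H^\infty(\mathbb D)$). $M_6(\mathcal M_d)$ is the algebra of $6\times 6$ matrices with entries in $\mathcal M_d$. A weak-$*$ closed algebra $\mathfrak B\subset B(\mathcal H)$ has property $\mathbb A_1(1)$ (acting on $\mathcal H$) if for every weak-$*$ continuous functional $\varphi$ on $\mathfrak B$ with $\|\varphi\|<1$ there exist $\xi,\eta\in\mathcal H$ with $\|\xi\|,\|\eta\|<1$ and $\varphi(b)=\langle b\xi,\eta\rangle$ for all $b\in\mathfrak B$. *)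

(* Defs.v *)
From HB Require Import structures.
From mathcomp Require Import all_boot all_order all_algebra.
From mathcomp Require Import complex.
From mathcomp Require Import all_classical all_reals all_analysis.
Import Order.TTheory GRing.Theory Num.Theory.
Import numFieldNormedType.Exports.

Set Implicit Arguments.
Unset Strict Implicit.
Unset Printing Implicit Defensive.

Local Open Scope classical_set_scope.
Local Open Scope ring_scope.

(** Inner products are linear in the first argument and conjugate-linear in
    the second, as in [sesquilinear]. *)

Definition hnorm_of (R : realType) (V : lmodType R[i])
  (form : V -> V -> R[i]) (x : V) : R := Num.sqrt (complex.Re (form x x)).

Definition complete_for (R : realType) (V : lmodType R[i])
    (form : V -> V -> R[i]) : Prop :=
  forall u : nat -> V,
    (forall e : R, 0 < e -> exists N : nat, forall m n : nat,
       (N <= m)%N -> (N <= n)%N -> hnorm_of form (u m - u n) < e) ->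
    exists l : V, hnorm_of form (u n - l) @[n --> \oo] --> (0 : R).

Record hilbert (R : realType) := Hilbert {
  hilbert_sort :> lmodType R[i];
  inner : {dot hilbert_sort for @Num.conj R[i]};
  hilbert_complete : complete_for inner }.

Arguments inner {R h}.

Definition hnorm (R : realType) (H : hilbert R) (x : H) : R :=
  hnorm_of inner x.

Section DirectSum.
Variables (R : realType) (H : hilbert R) (n : nat).

Definition dsum_inner (x y : {ffun 'I_n -> H}) : R[i] :=
  \sum_i inner (x i) (y i).

Lemma dsum_inner_bilinear :
  bilinear_for (GRing.Scale.Law.clone _ _ ( *%R ) _)
    (GRing.Scale.Law.clone _ _ (@Num.conj R[i] \; *%R ) _) dsum_inner.
Proof.
split=> [y a x x' | x a y y']; rewrite /dsum_inner.
  rewrite /= mulr_sumr -big_split /=; apply: eq_bigr => i _.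
  by rewrite !ffunE linearPl.
rewrite /= mulr_sumr -big_split /=; apply: eq_bigr => i _.
by rewrite !ffunE linearPr.
Qed.

HB.instance Definition _ := bilinear_isBilinear.Build R[i]
  {ffun 'I_n -> H} {ffun 'I_n -> H} R[i]
  (GRing.Scale.Law.clone _ _ ( *%R ) _)
  (GRing.Scale.Law.clone _ _ (@Num.conj R[i] \; *%R ) _)
  dsum_inner dsum_inner_bilinear.

Lemma dsum_inner_herm (x y : {ffun 'I_n -> H}) :
  dsum_inner x y = (-1) ^+ false * (dsum_inner y x)^*.
Proof.
rewrite expr0 mul1r /dsum_inner rmorph_sum /=; apply: eq_bigr => i _.
by rewrite hermC expr0 mul1r.
Qed.

HB.instance Definition _ :=
  isHermitianSesquilinear.Build R[i] {ffun 'I_n -> H} false (@Num.conj R[i])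
    dsum_inner dsum_inner_herm.

Lemma dsum_inner_gt0 (x : {ffun 'I_n -> H}) : x != 0 -> 0 < dsum_inner x x.
Proof.
move=> x0; rewrite lt0r /dsum_inner.
have ge0 (i : 'I_n) : 0 <= inner (x i) (x i) by exact: dnorm_ge0.
rewrite sumr_ge0 // andbT; apply: contra x0.
rewrite psumr_eq0 // => /allP x0; apply/eqP/ffunP => i; apply/eqP.
by rewrite ffunE -(dnorm_eq0 inner); apply: x0; rewrite mem_index_enum.
Qed.

HB.instance Definition _ :=
  isDotProduct.Build R[i] {ffun 'I_n -> H} dsum_inner dsum_inner_gt0.

Lemma dsum_hnorm (x : {ffun 'I_n -> H}) :
  hnorm_of dsum_inner x = Num.sqrt (\sum_i hnorm (x i) ^+ 2).
Proof.
rewrite /hnorm_of /dsum_inner raddf_sum /=; congr Num.sqrt.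
apply: eq_bigr => i _; rewrite /hnorm /hnorm_of sqr_sqrtr //.
by have := dnorm_ge0 inner (x i); rewrite lecE /= => /andP[].
Qed.

Lemma dsum_complete : complete_for dsum_inner.
Proof.
move=> u u_cauchy.
have lim_i (i : 'I_n) : exists l : H,
    hnorm_of inner (u m i - l) @[m --> \oo] --> (0 : R).
  apply: (@hilbert_complete _ H (fun m => u m i)) => e e0.
  have [N uN] := u_cauchy e e0; exists N => p q Np Nq.
  apply: le_lt_trans (uN p q Np Nq); rewrite dsum_hnorm.
  rewrite -[leLHS]ger0_norm ?sqrtr_ge0 // -sqrtr_sqr ler_sqrt; last first.
    by apply: sumr_ge0 => j _; rewrite sqr_ge0.
  rewrite (bigD1 i) //= !ffunE lerDl.
  by apply: sumr_ge0 => j _; rewrite sqr_ge0.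
have [l ul] := choice lim_i.
have sum0 : \sum_i hnorm (u m i - l i) ^+ 2 @[m --> \oo] --> (0 : R).
  elim: (index_enum _) => [|i s IHs].
    by under eq_fun do rewrite big_nil; exact: cvg_cst.
  under eq_fun do rewrite big_cons expr2.
  have := cvgD (cvgM (ul i) (ul i)) IHs; rewrite mulr0 addr0; exact.
have sqrt0 : Num.sqrt x @[x --> (0 : R)] --> (0 : R).
  by have := @sqrt_continuous R 0; rewrite /continuous_at sqrtr0.
exists [ffun i => l i].
under eq_fun do rewrite dsum_hnorm; under eq_fun do
  under eq_bigr do rewrite !ffunE.
exact: cvg_comp sum0 sqrt0.
Qed.

Definition dsum : hilbert R :=
  @Hilbert R {ffun 'I_n -> H} dsum_inner dsum_complete.

End DirectSum.

(** B(H), as a subset of the space of all maps from H to H. *)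

Definition bounded_op (R : realType) (H : hilbert R) : set (H -> H) :=
  [set T | linear T /\ exists M : R, forall x, hnorm (T x) <= M * hnorm x].

Definition opnorm (R : realType) (H : hilbert R) (T : H -> H) : \bar R :=
  ereal_sup [set (hnorm (T x))%:E | x in [set x : H | hnorm x <= 1]].

(** The weak-* topology of B(H), the dual of the trace class: the trace class
    operators are exactly the sums [\sum_k (u k) (v k)^*] over
    square-summable sequences u and v, and such an operator acts on B(H) as
    [T |-> \sum_k <T (u k), v k>]. *)

Definition sq_summable (R : realType) (H : hilbert R) (u : nat -> H) : Prop :=
  cvgn (series (fun k => hnorm (u k) ^+ 2)).

Definition sq_seq (R : realType) (H : hilbert R) : Type :=
  {u : nat -> H | sq_summable u}.

Definition trace_pairing (R : realType) (H : hilbert R) (T : H -> H) :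
    {ptws (sq_seq H * sq_seq H)%type -> R[i]^o} :=
  fun p => limn (series (fun k => inner (T (sval p.1 k)) (sval p.2 k) : R[i]^o)).

(** Maps outside B(H) carry no meaningful limits here: only the restriction of
    this topology to subsets of [bounded_op] is ever used. *)
Definition weak_star (R : realType) (H : hilbert R) :=
  initial_topology (@trace_pairing R H).

Definition linear_on (R : realType) (V : lmodType R[i]) (B : set V)
    (phi : V -> R[i]) : Prop :=
  forall (a : R[i]) (S T : V), B S -> B T -> phi (a *: S + T) = a * phi S + phi T.

Definition weak_star_continuous_on (R : realType) (H : hilbert R)
    (B : set (H -> H)) (phi : (H -> H) -> R[i]) : Prop :=
  {within (B : set (weak_star H)),
    continuous (phi : weak_star H -> R[i]^o)}.

Definition functional_norm (R : realType) (H : hilbert R)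
    (B : set (H -> H)) (phi : (H -> H) -> R[i]) : \bar R :=
  ereal_sup [set (complex.Re `|phi b|)%:E | b in
    [set b | B b /\ (opnorm b <= 1)%E]].

(** [phi] is a functional on [B]: its values outside [B] are irrelevant. *)
Definition property_A11 (R : realType) (H : hilbert R) (B : set (H -> H)) : Prop :=
  forall phi : (H -> H) -> R[i],
    linear_on B phi ->
    weak_star_continuous_on B phi ->
    (functional_norm B phi < 1)%E ->
    exists xi eta : H, [/\ hnorm xi < 1, hnorm eta < 1 &
      forall b, B b -> phi b = inner (b xi) eta].

Definition mx_op (R : realType) (H : hilbert R) (n : nat) (b : 'M[H -> H]_n) :
    dsum H n -> dsum H n :=
  fun x : {ffun 'I_n -> H} => [ffun i => \sum_j b i j (x j)].

Definition mx_algebra (R : realType) (H : hilbert R) (n : nat)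
    (A : set (H -> H)) : set (dsum H n -> dsum H n) :=
  [set mx_op b | b in [set b : 'M[H -> H]_n | forall i j, A (b i j)]].

Arguments mx_algebra {R H} n A.

(** A Hilbert space of functions on X with reproducing kernel k; an element f
    is identified with the function [rkhs_eval f]. *)

Record rkhs (R : realType) (X : Type) (k : X -> X -> R[i]) := Rkhs {
  rkhs_space :> hilbert R;
  rkhs_eval : rkhs_space -> X -> R[i];
  rkhs_eval_linear : forall (a : R[i]) (f g : rkhs_space) (x : X),
    rkhs_eval (a *: f + g) x = a * rkhs_eval f x + rkhs_eval g x;
  rkhs_eval_inj : injective rkhs_eval;
  rkhs_kernel : X -> rkhs_space;
  rkhs_kernelE : forall x w : X, rkhs_eval (rkhs_kernel w) x = k x w;
  rkhs_reproducing : forall (f : rkhs_space) (w : X),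
    rkhs_eval f w = inner f (rkhs_kernel w) }.

(** A multiplier phi is identified with its multiplication operator, whose
    boundedness is automatic by the closed graph theorem. *)
Definition multiplier_algebra (R : realType) (X : Type) (k : X -> X -> R[i])
    (H : rkhs k) : set (H -> H) :=
  [set T | bounded_op T /\ exists phi : X -> R[i],
     forall (f : H) (x : X), rkhs_eval (T f) x = phi x * rkhs_eval f x].

Arguments multiplier_algebra {R X k} H.

Definition unit_ball (R : realType) (d : nat) : Type :=
  {z : 'rV[R[i]]_d | \sum_(i < d) `|z 0 i| ^+ 2 < 1}.

Definition drury_arveson_kernel (R : realType) (d : nat)
    (z w : unit_ball R d) : R[i] :=
  (1 - \sum_(i < d) sval z 0 i * (sval w 0 i)^*)^-1.

(** The reproducing kernel Hilbert space of a given kernel exists and is unique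
    by the Moore-Aronszajn theorem; for this kernel its elements are
    automatically analytic functions on the ball. *)
Definition drury_arveson (R : realType) (d : nat) : Type :=
  rkhs (@drury_arveson_kernel R d).

(* Main.v *)
Require Import Defs.
From mathcomp Require Import all_boot all_order all_algebra.
From mathcomp Require Import complex.
From mathcomp Require Import all_classical all_reals all_analysis.
From mathcomp Require Import ring lra.
Import Order.TTheory GRing.Theory Num.Theory.
Import numFieldNormedType.Exports.

Set Implicit Arguments.
Unset Strict Implicit.
Unset Printing Implicit Defensive.

Local Open Scope classical_set_scope.
Local Open Scope ring_scope.

(** A functional given by one pair of vectors pairs the (i, j) matrix unit times
    a multiplier f with [<f xi_j, eta_i>].  In each dimension there is a
    functional of norm less than 1, of the form [\sum_(k < m) <b u_k, v_k>] and
    so weak-* continuous, whose values on matrix units contradict this form.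

    The tools are the coordinate multiplications T_i ([mulz]) and their adjoints
    S_i ([adjz]).  The kernel satisfies [k = 1 + <z, w> k], which says that
    [f = f(0) + \sum_i T_i S_i f], whence
    [|f|^2 = |f(0)|^2 + \sum_i |S_i f|^2] ([sqn_gleason]).

    Dimension 0 ([not_property_A11_dim0]).  The space is C, the algebra is that
    of all matrices, and a vector functional has rank one, whereas
    [b |-> (b_00 + b_11) / 4] has rank two.

    Dimension 1 ([not_property_A11_dim1]).  The functional is
    [b |-> (b_00(0) + b_11(0)) / 4].  If it is a vector functional, then
    [<T^k xi_j, eta_i>] vanishes unless k = 0 and i = j.  Let M be the invariant
    subspace generated by xi_0 and xi_1.  The projections of eta_0 and eta_1 to
    M are orthogonal to T M and linearly independent, which contradicts the fact
    behind the theorem of Beurling that M is generated by one wandering vector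
    ([wandering_dim1]): if x and y are wandering vectors generating orthogonal
    invariant subspaces, then the product function x y lies in both of them.

    Dimension at least 2 ([not_property_A11_dim_ge2]).  The column of z_1 and
    z_2 has norm [sqrt 2] on H, and it almost attains this norm only at vectors
    that are almost constant ([near_constant]).  The functional
    [b |-> s \sum_(j < 2) (<b_(j,j) 1, z_1> + <b_(j+2,j) 1, z_2>)], with s just
    below [1 / (2 sqrt 2)], is almost normed by two copies of that column.  If it
    is a vector functional, then xi_0 and xi_1 are therefore almost constants
    c_0 and c_1, and the values [s delta_ij] at the multiplier z_1 in position
    (i, j) are close to [c_j <z_1, eta_i>], a matrix of rank one
    ([rank_one_far_from_diag]). *)

(** * Hilbert space: squared norms and projections *)

Section InnerProduct.
Context {R : realType}.
Local Notation C := R[i].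
Local Notation Re := complex.Re.
Local Notation Im := complex.Im.

Definition nsq (z : C) : R := Re z ^+ 2 + Im z ^+ 2.

Lemma conjC_complex (z : C) : (z^*)%R = (Re z -i* Im z)%C.
Proof. by case: z. Qed.

Lemma conjC_real (r : R) : (r%:C%C)^* = r%:C%C.
Proof. by rewrite conjC_complex /= oppr0. Qed.

Lemma mul_conj_nsq (z : C) : z * z^* = (nsq z)%:C%C.
Proof.
rewrite conjC_complex /nsq; case: z => a b /=.
by apply/eqP; rewrite eq_complex /=; apply/andP; split; apply/eqP; ring.
Qed.

Lemma nsq_ge0 z : 0 <= nsq z.
Proof. by rewrite addr_ge0 ?sqr_ge0. Qed.

Lemma nsqM a b : nsq (a * b) = nsq a * nsq b.
Proof. by rewrite /nsq; case: a => a a'; case: b => b b' /=; ring. Qed.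

Lemma nsq_eq0 z : nsq z = 0 -> z = 0.
Proof.
move=> /eqP; rewrite /nsq paddr_eq0 ?sqr_ge0 // !sqrf_eq0 => /andP[/eqP a /eqP b].
by apply/eqP; rewrite eq_complex a b /= eqxx.
Qed.

Lemma nsq_real (a : R) : nsq a%:C%C = a ^+ 2.
Proof. by rewrite /nsq /= expr0n addr0. Qed.

Variable H : hilbert R.
Implicit Types x y z : H.

Definition sqn x : R := Re (inner x x).

Lemma ipC x y : inner x y = (inner y x)^*.
Proof. by rewrite hermC expr0 mul1r. Qed.
Lemma ipDl x y z : inner (x + y) z = inner x z + inner y z.
Proof. by rewrite linearDl. Qed.
Lemma ipBl x y z : inner (x - y) z = inner x z - inner y z.
Proof. by rewrite linearBl. Qed.
Lemma ipZl a x z : inner (a *: x) z = a * inner x z.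
Proof. by rewrite linearZl_LR. Qed.
Lemma ip0l z : inner 0 z = 0 :> C.
Proof. by rewrite linear0l. Qed.
Lemma ipDr x y z : inner z (x + y) = inner z x + inner z y.
Proof. by rewrite linearDr. Qed.
Lemma ipBr x y z : inner z (x - y) = inner z x - inner z y.
Proof. by rewrite linearBr. Qed.
Lemma ipNr x z : inner z (- x) = - inner z x.
Proof. by rewrite linearNr. Qed.
Lemma ipNl x z : inner (- x) z = - inner x z.
Proof. by rewrite linearNl. Qed.
Lemma ipZr a x z : inner z (a *: x) = a^* * inner z x.
Proof. by rewrite linearZr_LR. Qed.
Lemma ip0r z : inner z 0 = 0 :> C.
Proof. by rewrite linear0r. Qed.

Lemma ipxx x : inner x x = (sqn x)%:C%C.
Proof.
rewrite /sqn; have := dnorm_ge0 inner x; rewrite lecE /= => /andP[/eqP i0 _].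
by case: (inner x x) i0 => a b /= ->.
Qed.

Lemma sqn_ge0 x : 0 <= sqn x.
Proof. by have := dnorm_ge0 inner x; rewrite lecE /= => /andP[]. Qed.

Lemma sqn_eq0 x : sqn x = 0 -> x = 0.
Proof. by move=> h; apply/eqP; rewrite -(dnorm_eq0 inner) ipxx h. Qed.

Lemma sqn0 : sqn 0 = 0.
Proof. by rewrite /sqn ip0l. Qed.

Lemma hnormE x : hnorm x = Num.sqrt (sqn x).
Proof. by []. Qed.

Lemma hnorm_sqr x : hnorm x ^+ 2 = sqn x.
Proof. by rewrite hnormE sqr_sqrtr // sqn_ge0. Qed.

Lemma sqnD x y : sqn (x + y) = sqn x + sqn y + 2 * Re (inner x y).
Proof.
rewrite /sqn ipDl !ipDr (ipC y x) conjC_complex !raddfD /=; ring.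
Qed.

Lemma sqnZ a x : sqn (a *: x) = nsq a * sqn x.
Proof.
rewrite {1}/sqn ipZl ipZr mulrA mul_conj_nsq ipxx -rmorphM //.
Qed.

Lemma sqnN x : sqn (- x) = sqn x.
Proof. by rewrite /sqn ipNl ipNr opprK. Qed.

Lemma sqnB x y : sqn (x - y) = sqn x + sqn y - 2 * Re (inner x y).
Proof. by rewrite sqnD sqnN ipNr raddfN /= mulrN. Qed.


(** The choice of coefficient that makes the norm smallest: it yields both the
    Cauchy-Schwarz inequality and the orthogonality of minimizers. *)
Lemma sqn_sub_proj x q : q != 0 ->
  sqn (x - (inner x q / (sqn q)%:C%C) *: q) = sqn x - nsq (inner x q) / sqn q.
Proof.
move=> q0; have nq0 : sqn q != 0 by apply: contra_neq q0; exact: sqn_eq0.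
rewrite sqnB sqnZ ipZr nsqM.
have -> : ((sqn q)%:C%C)^-1 = ((sqn q)^-1)%:C%C by rewrite fmorphV.
rewrite nsq_real.
have -> : Re ((inner x q * ((sqn q)^-1)%:C%C)^* * inner x q) = nsq (inner x q) / sqn q.
  rewrite conjC_complex.
  by rewrite /nsq; case: (inner x q) => a b /=; ring.
by field; exact: nq0.
Qed.

Lemma cauchy_schwarz x y : nsq (inner x y) <= sqn x * sqn y.
Proof.
have [->|y0] := eqVneq y 0.
  by rewrite ip0r sqn0 mulr0 nsq_real expr0n.
have nq0 : 0 < sqn y.
  by rewrite lt_neqAle sqn_ge0 andbT eq_sym; apply: contra_neq y0; exact: sqn_eq0.
have := sqn_ge0 (x - (inner x y / (sqn y)%:C%C) *: y).
by rewrite sqn_sub_proj // subr_ge0 ler_pdivrMr.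
Qed.

(** Every closed subspace used below is described by equations [inner p g = 0];
    in this form closedness needs no separate statement. *)
Definition annihilator (G : H -> Prop) (p : H) : Prop :=
  forall g, G g -> inner p g = 0.

Lemma annihilator_lin G (a : C) p q :
  annihilator G p -> annihilator G q -> annihilator G (a *: p + q).
Proof. by move=> Gp Gq g Gg; rewrite ipDl ipZl Gp // Gq // mulr0 addr0. Qed.

(** A minimizing sequence for the distance from [v] is Cauchy by the
    parallelogram identity.  The inner products of [v - u n] with the subspace are
    bounded by the defect of minimality, so they vanish in the limit. *)
Theorem orthogonal_projection (G : H -> Prop) (v : H) :
  exists2 p, annihilator G p & forall q, annihilator G q -> inner (v - p) q = 0.
Proof.
pose E : set R := [set r | exists2 p, annihilator G p & r = sqn (v - p)].
have ann0 : annihilator G 0 by move=> g _; rewrite ip0l.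
have E0 : has_inf E.
  split; first by exists (sqn (v - 0)), 0.
  by exists 0 => _ [p _ ->]; exact: sqn_ge0.
set m := inf E.
have mle p : annihilator G p -> m <= sqn (v - p).
  by move=> Gp; apply: ge_inf; [case: E0 | exists p].
have near_min (n : nat) : exists p, annihilator G p /\ sqn (v - p) < m + n.+1%:R^-1.
  have [|_ [p Gp ->] lt] := @inf_adherent _ E n.+1%:R^-1 _ E0.
    by rewrite invr_gt0.
  by exists p.
have [u uP] := choice near_min.
have midpoint p q : sqn (p - q) =
    2 * sqn (v - p) + 2 * sqn (v - q) - 4 * sqn (v - 2^-1 *: (p + q)).
  have -> : p - q = (v - q) - (v - p) by rewrite opprB [RHS]addrC addrA subrK.
  have -> : v - 2^-1 *: (p + q) = 2^-1 *: ((v - p) + (v - q)).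
    rewrite [in RHS]addrACA -opprD scalerBr; congr (_ - _).
    by rewrite -{2 3}[v]scale1r -scalerDl scalerA mulVf ?scale1r // (pnatr_eq0 _ 2).
  rewrite sqnZ (sqnB (v - q) (v - p)) (sqnD (v - p) (v - q)).
  have -> : nsq (2^-1 : C) = 4^-1.
    have -> : (2^-1 : C) = (2^-1 : R)%:C%C by rewrite fmorphV rmorph_nat.
    by rewrite nsq_real; field.
  rewrite (ipC (v - p)) conjC_complex /=; by field.
have cauchy (k l : nat) : sqn (u k - u l) <= 2 * k.+1%:R^-1 + 2 * l.+1%:R^-1.
  have [Gk lk] := uP k; have [Gl ll] := uP l.
  have := mle (2^-1 *: (u k + u l)) _ => h; rewrite midpoint.
  have h2 : m <= sqn (v - 2^-1 *: (u k + u l)).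
    apply: h; rewrite -[_ *: _]addr0; apply: annihilator_lin => //.
    by rewrite -[u k]scale1r; apply: annihilator_lin.
  move: lk ll h2; move: (k.+1%:R^-1) (l.+1%:R^-1) => a b.
  by move: (sqn _) (sqn _) (sqn _) => ? ? ?; lra.
have inv_small (e : R) : 0 < e -> exists N : nat, forall n, (N <= n)%N -> n.+1%:R^-1 < e.
  move=> e0; exists (Num.truncn e^-1) => n Nn.
  rewrite invf_plt ?posrE //.
  apply: lt_le_trans (_ : (Num.truncn e^-1).+1%:R <= _).
    by rewrite truncnS_gt.
  by rewrite ler_nat ltnS.
have [|l ul] := @hilbert_complete _ H u.
  move=> e e0; have [|N Nsmall] := inv_small (e ^+ 2 / 4).
    by rewrite divr_gt0 ?exprn_gt0.
  exists N => k l Nk Nl.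
  have := cauchy k l; have := Nsmall k Nk; have := Nsmall l Nl => h1 h2 h3.
  rewrite -(ltr_pXn2r (n:=2)) ?nnegrE ?sqrtr_ge0 ?(ltW e0) // hnorm_sqr.
  move: h1 h2 h3; move: (k.+1%:R^-1) (l.+1%:R^-1) (sqn _) => a b c.
  by move: (e ^+ 2) => ? ? ? ?; lra.
have close (e : R) : 0 < e -> exists n, sqn (u n - l) < e /\ sqn (v - u n) < m + e.
  move=> e0; have se0 : 0 < Num.sqrt e by rewrite sqrtr_gt0.
  have [N Nsmall] := inv_small e e0.
  move/cvgrPdist_lt: ul => /(_ _ se0) [M _ Ml].
  exists (maxn N M); have := Ml (maxn N M) (leq_maxr _ _).
  rewrite sub0r normrN ger0_norm ?sqrtr_ge0 // ltr_sqrt // => h; split=> //.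
  have [_ h2] := uP (maxn N M); apply: lt_trans h2 _.
  by rewrite ltrD2l Nsmall // leq_maxl.
have nsq_small (z : C) (K : R) : 0 <= K ->
    (forall e, 0 < e -> nsq z <= e * K) -> z = 0.
  move=> K0 h; apply: nsq_eq0; apply/le_anti; rewrite nsq_ge0 andbT.
  apply/ler_addgt0Pr => e e0; rewrite add0r.
  have K1 : 0 < K + 1 by rewrite ltr_wpDl.
  apply: le_trans (h (e / (K + 1)) _) _; first by rewrite divr_gt0.
  by rewrite mulrAC ler_pdivrMr // ler_pM2l // lerDl.
exists l.
  move=> g Gg; apply: (nsq_small _ (sqn g) (sqn_ge0 g)) => e e0.
  have [n [un _]] := close e e0; have [Gn _] := uP n.
  have -> : inner l g = - inner (u n - l) g by rewrite ipBl Gn // sub0r opprK.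
  rewrite -ipNl; apply: le_trans (cauchy_schwarz _ _) _.
  by rewrite sqnN ler_wpM2r ?sqn_ge0 // ltW.
move=> q Gq; have [->|q0] := eqVneq q 0; first by rewrite ip0r.
have nq0 : 0 < sqn q.
  by rewrite lt_neqAle sqn_ge0 andbT eq_sym; apply: contra_neq q0; exact: sqn_eq0.
apply: (nsq_small _ (4 * sqn q)); first by rewrite mulr_ge0 // ltW.
move=> e e0; have [n [un vn]] := close e e0; have [Gn _] := uP n.
have b1 : nsq (inner (v - u n) q) <= e * sqn q.
  have := mle (u n + (inner (v - u n) q / (sqn q)%:C%C) *: q) _.
  rewrite opprD addrA sqn_sub_proj // => h.
  have h2 : m <= sqn (v - u n) - nsq (inner (v - u n) q) / sqn q.
    by apply: h; rewrite addrC; apply: annihilator_lin.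
  by rewrite -ler_pdivrMr //; lra.
have b2 : nsq (inner (u n - l) q) <= e * sqn q.
  by apply: le_trans (cauchy_schwarz _ _) _; rewrite ler_wpM2r ?sqn_ge0 // ltW.
have -> : v - l = (v - u n) + (u n - l) by rewrite addrA subrK.
rewrite ipDl; move: b1 b2; rewrite /nsq.
case: (inner _ _) => a b; case: (inner _ _) => c d /=.
have := sqr_ge0 (a - c); have := sqr_ge0 (b - d); lra.
Qed.

Lemma dsum_innerE n (x y : dsum H n) : inner x y = \sum_i inner (x i) (y i).
Proof. by []. Qed.

End InnerProduct.

(** * Coordinate multiplications on the Drury-Arveson space and their adjoints *)

Section DruryArveson.
Variables (R : realType) (d : nat) (H : drury_arveson R d).
Local Notation C := R[i].
Local Notation Re := complex.Re.
Local Notation Im := complex.Im.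
Local Notation ball := (unit_ball R d).
Local Notation ev := (@rkhs_eval R ball _ H).
Local Notation ker := (@rkhs_kernel R ball _ H).
Local Notation "z _| i" := (sval z 0 i) (at level 2).
Implicit Types (f g : H) (z w : ball) (i : 'I_d).

Lemma origin_subproof : \sum_(i < d) `|(0 : 'rV[C]_d) 0 i| ^+ 2 < 1.
Proof. by rewrite big1 ?ltr01 // => i _; rewrite mxE normr0 expr0n. Qed.

Definition origin : ball := exist _ 0 origin_subproof.

Lemma originE i : origin _| i = 0.
Proof. by rewrite /= mxE. Qed.

Lemma ev_ker z w : ev (ker w) z = drury_arveson_kernel z w.
Proof. exact: rkhs_kernelE. Qed.

Lemma ev_inner f w : ev f w = inner f (ker w).
Proof. exact: rkhs_reproducing. Qed.

Lemma ev_ext f g : (forall w, ev f w = ev g w) -> f = g.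
Proof. by move=> fg; apply: rkhs_eval_inj; apply/funext. Qed.

Lemma evD f g w : ev (f + g) w = ev f w + ev g w.
Proof. by rewrite -[f]scale1r rkhs_eval_linear scale1r mul1r. Qed.

Lemma ev0 w : ev 0 w = 0.
Proof. by rewrite ev_inner ip0l. Qed.

Lemma evZ a f w : ev (a *: f) w = a * ev f w.
Proof. by rewrite -[_ *: _]addr0 rkhs_eval_linear ev0 addr0. Qed.

Lemma evN f w : ev (- f) w = - ev f w.
Proof. by rewrite -scaleN1r evZ mulN1r. Qed.

Lemma kernel_denom_neq0 z w : 1 - \sum_(i < d) z _| i * (w _| i)^* != 0.
Proof.
have nsqE (u : ball) : \sum_(i < d) nsq (u _| i) < 1.
  have := svalP u; rewrite (eq_bigr (fun i => (nsq (u _| i))%:C%C)).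
    by rewrite -rmorph_sum /= (ltcR _ 1).
  by move=> i _; rewrite normCK mul_conj_nsq.
apply/eqP => /eqP; rewrite subr_eq0 => /eqP /(congr1 (@complex.Re R)) /=.
rewrite raddf_sum /= => sum1.
have : \sum_(i < d) Re (z _| i * (w _| i)^*) <=
       \sum_(i < d) (nsq (z _| i) + nsq (w _| i)) / 2.
  apply: ler_sum => i _; rewrite conjC_complex /nsq.
  case: (z _| i) => a b; case: (w _| i) => a' b' /=.
  by have := sqr_ge0 (a - a'); have := sqr_ge0 (b - b'); lra.
rewrite -mulr_suml big_split /= -sum1.
by have := nsqE z; have := nsqE w; lra.
Qed.

(** This identity determines the structure of the space: it says that
    [ker w] is sent isometrically to the tuple
    [(ker origin, w_1^* ker w, ..., w_d^* ker w)], which is the adjoint of the row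
    operator [(c, g_1, ..., g_d) |-> c(0) + \sum_i z_i g_i]. *)
Lemma kernel_identity z w :
  ev (ker w) z = 1 + \sum_(i < d) z _| i * ((w _| i)^* * ev (ker w) z).
Proof.
rewrite ev_ker /drury_arveson_kernel.
under [X in _ = 1 + X]eq_bigr do rewrite mulrA.
rewrite -mulr_suml; have := kernel_denom_neq0 z w.
move: (\sum_(i < d) _) => s s0; field.
exact: s0.
Qed.

Lemma ev_ker0 w : ev (ker origin) w = 1.
Proof.
rewrite kernel_identity big1 ?addr0 // => i _.
by rewrite originE rmorph0 mul0r mulr0.
Qed.

Lemma nsq_ev_le f w : nsq (ev f w) <= sqn f * sqn (ker w).
Proof. by rewrite ev_inner cauchy_schwarz. Qed.

Lemma sqn_ker w : sqn (ker w) = (1 - \sum_i nsq (sval w 0 i))^-1.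
Proof.
rewrite /sqn -ev_inner ev_ker /drury_arveson_kernel.
under eq_bigr do rewrite mul_conj_nsq.
rewrite -rmorph_sum; move: (\sum_i _) => a.
by have -> : (1 - a%:C%C : C)^-1 = ((1 - a)^-1)%:C%C by rewrite fmorphV rmorphB rmorph1.
Qed.

Lemma sqn_ker0 : sqn (ker origin) = 1.
Proof. by rewrite /sqn -ev_inner ev_ker0. Qed.

Lemma axis_point i (r : R) : r ^+ 2 < 1 ->
  exists w, forall l, sval w 0 l = if l == i then r%:C%C else 0.
Proof.
move=> r1; pose z : 'rV[C]_d := \row_l if l == i then r%:C%C else 0.
have zP : \sum_l `|z 0 l| ^+ 2 < 1.
  rewrite (bigD1 i) //= mxE eqxx normCK mul_conj_nsq nsq_real big1 ?addr0 ?(ltcR _ 1) //.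
  by move=> l li; rewrite mxE (negbTE li) normr0 expr0n.
exists (exist (fun z : 'rV[C]_d => is_true (\sum_(i < d) `|z 0 i| ^+ 2 < 1)) _ zP) => l.
by rewrite mxE.
Qed.

Definition ffun_cons n (x : H) (y : {ffun 'I_n -> H}) : {ffun 'I_n.+1 -> H} :=
  [ffun k => if unlift ord0 k is Some i then y i else x].

Lemma inner_ffun_cons n (v : dsum H n.+1) x (y : {ffun 'I_n -> H}) :
  inner v (ffun_cons x y : dsum H n.+1) =
  inner (v ord0) x + \sum_i inner (v (lift ord0 i)) (y i).
Proof.
rewrite dsum_innerE big_ord_recl /ffun_cons ffunE unlift_none.
by under eq_bigr do rewrite ffunE liftK.
Qed.

Local Notation K := (dsum H d.+2).
Local Notation l0 := (lift ord0 ord0).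
Local Notation lS i := (lift ord0 (lift ord0 i)).
Implicit Types v t : K.

Definition triple (x c : H) (y : {ffun 'I_d -> H}) : K := ffun_cons x (ffun_cons c y).

Lemma inner_triple v x c y : inner v (triple x c y) =
  inner (v ord0) x + (inner (v l0) c + \sum_i inner (v (lS i)) (y i)).
Proof.
rewrite inner_ffun_cons big_ord_recl /ffun_cons ffunE unlift_none.
by under eq_bigr do rewrite ffunE liftK.
Qed.

Lemma triple0 x c y : triple x c y ord0 = x.
Proof. by rewrite ffunE unlift_none. Qed.
Lemma triple1 x c y : triple x c y l0 = c.
Proof. by rewrite ffunE liftK ffunE unlift_none. Qed.
Lemma tripleS x c y i : triple x c y (lS i) = y i.
Proof. by rewrite ffunE liftK ffunE liftK. Qed.

(** The row operator [(c, y) |-> c(0) + \sum_i z_i y_i] on the last components,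
    as a function on the ball; that its values lie in H is proved below. *)
Definition row_val (v : K) w : C := ev (v l0) origin + \sum_i w _| i * ev (v (lS i)) w.

Definition kernel_triple (e : C) w : K :=
  triple (e *: ker w) (ker origin) [ffun i => (w _| i)^* *: ker w].

Lemma inner_kernel_triple v e w : inner v (kernel_triple e w) = e^* * ev (v ord0) w + row_val v w.
Proof.
rewrite inner_triple ipZr -!ev_inner; congr (_ + (_ + _)).
by apply: eq_bigr => i _; rewrite ffunE ipZr conjCK ev_inner.
Qed.

(** The graph of minus the row operator, as a closed subspace of the direct sum
    that is defined before the operator is known to exist.  Its orthogonal
    complement is the graph of the adjoint of the row operator. *)
Definition neg_row_graph v := annihilator (fun u => exists w, u = kernel_triple 1 w) v.

Lemma neg_row_graphP v : neg_row_graph v <-> forall w, row_val v w = - ev (v ord0) w.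
Proof.
split=> [vG w | h _ [w ->]].
  apply/eqP; rewrite -addr_eq0 addrC; apply/eqP.
  by rewrite -[RHS](vG (kernel_triple 1 w)) ?inner_kernel_triple ?rmorph1 ?mul1r //; exists w.
by rewrite inner_kernel_triple h rmorph1 mul1r subrr.
Qed.

Lemma neg_row_graph_kernel w : neg_row_graph (kernel_triple (- 1) w).
Proof.
apply/neg_row_graphP => z; rewrite /row_val triple0 triple1 evZ mulN1r opprK ev_ker0.
rewrite [RHS]kernel_identity; congr (_ + _).
by apply: eq_bigr => i _; rewrite tripleS ffunE evZ.
Qed.

(** The complement of the graph lies in the graph of plus the row operator, since
    by [kernel_identity] the vectors [kernel_triple (-1) w] lie in the graph.  So
    a vector [t] splits into two vectors on which the row operator is known up to
    sign. *)
Lemma neg_row_graph_split t : exists2 r : K, neg_row_graph (t - r) &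
  (forall u, neg_row_graph u -> inner r u = 0) /\ forall w, row_val r w = ev (r ord0) w.
Proof.
have [p pG pP] := @orthogonal_projection _ K (fun u => exists w, u = kernel_triple 1 w) t.
exists (t - p); first by rewrite opprB addrC subrK.
split=> // w; have := pP _ (neg_row_graph_kernel w).
rewrite inner_kernel_triple rmorphN1 mulN1r => /eqP.
by rewrite addrC subr_eq0 => /eqP.
Qed.

Lemma row_valB v t w : row_val (v - t) w = row_val v w - row_val t w.
Proof.
rewrite /row_val !ffunE evD evN opprD addrACA; congr (_ + _).
rewrite -sumrB; apply: eq_bigr => i _.
by rewrite !ffunE evD evN mulrBr.
Qed.

(** Splitting [(0; 0, f e_i)], the two first components are opposite, so that
    the row operator takes at [f e_i] the value [2 r_0]. *)
Lemma mulz_subproof i f : exists h, forall w, ev h w = w _| i * ev f w.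
Proof.
pose t := triple 0 0 [ffun j => if j == i then f else 0].
have [r /neg_row_graphP rG [_ rr]] := neg_row_graph_split t.
exists (r ord0 + r ord0) => w; have := rG w.
rewrite row_valB rr !ffunE unlift_none evD evN ev0 add0r opprK evD => /eqP.
rewrite subr_eq => /eqP <-.
rewrite /row_val triple1 ev0 add0r (bigD1 i) //= tripleS ffunE eqxx big1 ?addr0 //.
by move=> j ji; rewrite tripleS ffunE (negbTE ji) ev0 mulr0.
Qed.

Definition mulz i f : H := sval (cid (mulz_subproof i f)).

Lemma ev_mulz i f w : ev (mulz i f) w = w _| i * ev f w.
Proof. by rewrite /mulz; case: cid. Qed.

(** Splitting [(f; 0, 0)], the row operator sends [2 r] to [f], and [2 r] is the
    image of [f] under the adjoint because [r] is orthogonal to the graph. *)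
Lemma adjz_subproof f : exists s : {ffun 'I_d -> H},
  (forall i g, inner (s i) g = inner f (mulz i g)) /\
  forall w, ev f w = ev f origin + \sum_i w _| i * ev (s i) w.
Proof.
have [r /neg_row_graphP rG [rP rr]] := neg_row_graph_split (triple f 0 [ffun=> 0]).
have fE : f = r ord0 + r ord0.
  apply: ev_ext => w; have := rG w.
  rewrite row_valB rr !ffunE unlift_none !evD evN.
  rewrite /row_val triple1 ev0 add0r big1 ?add0r ?opprD ?opprK; last first.
    by move=> i _; rewrite tripleS ffunE ev0 mulr0.
  by move/eqP; rewrite eq_sym addrC subr_eq addrC eq_sym subr_eq => /eqP.
exists [ffun i => r (lS i) + r (lS i)]; split=> [i g|w].
  have : inner r (triple (- mulz i g) 0 [ffun j => if j == i then g else 0]) = 0.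
    apply: rP; apply/neg_row_graphP => w; rewrite /row_val triple0 triple1 ev0 add0r.
    rewrite (bigD1 i) //= tripleS ffunE eqxx evN opprK ev_mulz big1 ?addr0 //.
    by move=> j ji; rewrite tripleS ffunE (negbTE ji) ev0 mulr0.
  rewrite inner_triple ip0r add0r ipNr (bigD1 i) //= ffunE eqxx big1 => [|j ji].
    rewrite addr0 addrC => /eqP; rewrite subr_eq0 ffunE ipDl => /eqP ->.
    by rewrite fE ipDl.
  by rewrite ffunE (negbTE ji) ip0r.
have f0 : ev (r l0) origin = ev (r ord0) origin.
  have : inner r (triple (- ker origin) (ker origin) [ffun=> 0]) = 0.
    apply: rP; apply/neg_row_graphP => v; rewrite /row_val triple0 triple1 evN opprK !ev_ker0.
    by rewrite big1 ?addr0 // => i _; rewrite tripleS ffunE ev0 mulr0.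
  rewrite inner_triple; under eq_bigr do rewrite ffunE ip0r.
  rewrite big1_eq.
  by rewrite addr0 ipNr -!ev_inner addrC => /eqP; rewrite subr_eq0 => /eqP.
rewrite {1 2}fE !evD -rr /row_val f0 addrACA; congr (_ + _).
rewrite -big_split; apply: eq_bigr => i _ /=.
by rewrite ffunE evD mulrDr.
Qed.

Definition adjz i f : H := sval (cid (adjz_subproof f)) i.

Lemma inner_adjz i f g : inner (adjz i f) g = inner f (mulz i g).
Proof. by rewrite /adjz; case: cid => s /= [h _]; exact: h. Qed.

Lemma gleason f w : ev f w = ev f origin + \sum_i w _| i * ev (adjz i f) w.
Proof. by rewrite /adjz; case: cid => s /= [_ h]; exact: h. Qed.

Lemma inner_mulz i f g : inner (mulz i f) g = inner f (adjz i g).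
Proof. by rewrite ipC -inner_adjz -ipC. Qed.

Lemma inner_ext f g : (forall h, inner f h = inner g h) -> f = g.
Proof. by move=> fg; apply: ev_ext => w; rewrite !ev_inner fg. Qed.

Lemma mulz_linear i : linear (mulz i).
Proof.
move=> a f g; apply: ev_ext => w.
by rewrite ev_mulz rkhs_eval_linear rkhs_eval_linear !ev_mulz mulrDr mulrCA.
Qed.

Lemma adjz_linear i : linear (adjz i).
Proof.
move=> a f g; apply: inner_ext => h.
by rewrite inner_adjz !ipDl !ipZl !inner_adjz.
Qed.

Lemma adjzB i f g : adjz i (f - g) = adjz i f - adjz i g.
Proof. by apply: inner_ext => h; rewrite inner_adjz !ipBl !inner_adjz. Qed.

Lemma mulzB i f g : mulz i (f - g) = mulz i f - mulz i g.
Proof. by apply: inner_ext => h; rewrite inner_mulz !ipBl !inner_mulz. Qed.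

Lemma mulzC i j f : mulz i (mulz j f) = mulz j (mulz i f).
Proof. by apply: ev_ext => w; rewrite !ev_mulz mulrCA. Qed.

Lemma adjzC i j f : adjz i (adjz j f) = adjz j (adjz i f).
Proof. by apply: inner_ext => h; rewrite !inner_adjz mulzC. Qed.

Lemma ev_sum (I : finType) (F : I -> H) w : ev (\sum_i F i) w = \sum_i ev (F i) w.
Proof.
apply: (big_morph (fun f => ev f w)) => [f g|]; [exact: evD | exact: ev0].
Qed.

(** The solution of the Gleason problem: [1 - \sum_i T_i S_i] is the projection
    to the constants. *)
Lemma gleasonE f : f = ev f origin *: ker origin + \sum_i mulz i (adjz i f).
Proof.
apply: ev_ext => w; rewrite gleason evD evZ ev_ker0 mulr1 ev_sum.
by under [in RHS]eq_bigr do rewrite ev_mulz.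
Qed.

Lemma inner_ker_l f w : inner (ker w) f = (ev f w)^*.
Proof. by rewrite ipC -ev_inner. Qed.

Lemma sqn_gleason f : sqn f = nsq (ev f origin) + \sum_i sqn (adjz i f).
Proof.
rewrite {1}/sqn {1}[f]gleasonE ipDl ipZl inner_ker_l mul_conj_nsq raddfD /=.
rewrite linear_sumlz raddf_sum /=; congr (_ + _).
by apply: eq_bigr => i _; rewrite inner_mulz.
Qed.

Lemma sqn_adjz_sum_le f : \sum_i sqn (adjz i f) <= sqn f.
Proof. by rewrite [leRHS]sqn_gleason lerDr nsq_ge0. Qed.

Lemma sqn_adjz_le i f : sqn (adjz i f) <= sqn f.
Proof.
apply: le_trans (sqn_adjz_sum_le f); rewrite (bigD1 i) //= lerDl.
by apply: sumr_ge0 => j _; exact: sqn_ge0.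
Qed.

(** [|T f|^2 = <S T f, f>] and S is a contraction. *)
Lemma sqn_mulz_le i f : sqn (mulz i f) <= sqn f.
Proof.
have [->|n0] := eqVneq (sqn (mulz i f)) 0; first exact: sqn_ge0.
have n0' : 0 < sqn (mulz i f) by rewrite lt_neqAle eq_sym n0 sqn_ge0.
rewrite -(ler_pM2l n0').
have -> : sqn (mulz i f) * sqn (mulz i f) = nsq (inner (adjz i (mulz i f)) f).
  by rewrite inner_adjz ipxx nsq_real.
apply: le_trans (cauchy_schwarz _ _) _.
by rewrite ler_wpM2r ?sqn_ge0 // sqn_adjz_le.
Qed.

End DruryArveson.

(** * Functionals of finite rank *)

Section FiniteRank.
Variables (R : realType) (H : hilbert R).
Local Notation C := R[i].
Implicit Types (u v : nat -> H) (B : set (H -> H)).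

(** Finite families enter the trace pairing as sequences that are finally zero. *)
Definition cutoff m u : nat -> H := fun k => if (k < m)%N then u k else 0.

Lemma series_cutoff (V : zmodType) (F : nat -> V) m n :
  (forall k, (m <= k)%N -> F k = 0) -> (m <= n)%N -> series F n = \sum_(k < m) F k.
Proof.
move=> F0 mn; rewrite /series /= (big_cat_nat (n := m)) //= big_mkord.
rewrite [X in _ + X](_ : _ = 0) ?addr0 //.
by rewrite big_nat big1 // => k /andP[mk _]; exact: F0.
Qed.

Lemma cvg_series_cutoff (K : numFieldType) (V : normedModType K) (F : nat -> V) m :
  (forall k, (m <= k)%N -> F k = 0) -> series F @ \oo --> \sum_(k < m) F k.
Proof.
move=> F0; apply: cvg_near_cst; exists m => // n /= mn; exact: series_cutoff.
Qed.

Lemma sq_summable_cutoff m u : sq_summable (cutoff m u).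
Proof.
apply/cvg_ex; eexists; apply: (@cvg_series_cutoff _ R^o _ m) => k mk.
by rewrite /cutoff ltnNge mk /= hnorm_sqr sqn0.
Qed.

Lemma trace_pairing_cutoff m u v (T : H -> H) :
  trace_pairing T (exist _ _ (@sq_summable_cutoff m u), exist _ _ (@sq_summable_cutoff m v)) =
  \sum_(k < m) inner (T (u k)) (v k).
Proof.
rewrite /trace_pairing /=; apply: cvg_lim; first exact: norm_hausdorff.
rewrite [X in _ --> X](_ : _ = \sum_(k < m)
   (inner (T (cutoff m u k)) (cutoff m v k) : C^o)); last first.
  by apply: eq_bigr => k _; rewrite /cutoff ltn_ord.
apply: (@cvg_series_cutoff _ C^o) => k mk.
by rewrite /cutoff ltnNge mk /= ip0r.
Qed.

Definition finite_rank m u v (T : H -> H) : C := \sum_(k < m) inner (T (u k)) (v k).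

Lemma finite_rank_linear m u v B : linear_on B (finite_rank m u v).
Proof.
move=> a S T _ _; rewrite /finite_rank mulr_sumr -big_split /=.
by apply: eq_bigr => k _; rewrite ipDl ipZl.
Qed.

Lemma finite_rank_continuous m u v B : weak_star_continuous_on B (finite_rank m u v).
Proof.
apply: continuous_subspaceT => T.
set p := (exist _ _ (@sq_summable_cutoff m u), exist _ _ (@sq_summable_cutoff m v)).
have -> : (finite_rank m u v : weak_star H -> C^o) =
    (fun f : {ptws (sq_seq H * sq_seq H)%type -> C^o} => f p) \o @trace_pairing R H.
  by apply/funext => S; rewrite /= trace_pairing_cutoff.
apply: continuous_comp; first exact: initial_continuous.
exact: (@proj_continuous {classic (sq_seq H * sq_seq H)%type} (fun _ => C^o) p).
Qed.

Lemma finite_rank_norm_lt1 m u v (a : nat -> R) B :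
  (forall k, (k < m)%N -> sqn (u k) <= 1) ->
  (forall k, (k < m)%N -> 0 <= a k /\ sqn (v k) <= a k ^+ 2) ->
  \sum_(k < m) a k < 1 ->
  (functional_norm B (finite_rank m u v) < 1)%E.
Proof.
move=> u1 va a1; apply: le_lt_trans (_ : (\sum_(k < m) a k)%:E < 1)%E; last first.
  by rewrite lte_fin.
apply: ge_ereal_sup => _ [T [_ T1] <-]; rewrite lee_fin.
rewrite -lecR RRe_real ?normr_real // /finite_rank.
apply: le_trans (ler_norm_sum _ _ _) _.
rewrite rmorph_sum /=; apply: ler_sum => k _.
have [a0 vk] := va k (ltn_ord k); have uk := u1 k (ltn_ord k).
have Tu : sqn (T (u k)) <= 1.
  have : ((hnorm (T (u k)))%:E <= 1)%E.
    apply: le_trans T1; apply: ereal_sup_ubound; exists (u k) => //=.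
    by rewrite hnormE -sqrtr1 ler_sqrt.
  rewrite lee_fin hnormE => h.
  by rewrite -hnorm_sqr hnormE expr_le1 // sqrtr_ge0.
rewrite normc_def lecR -[leRHS]ger0_norm // -sqrtr_sqr ler_sqrt ?sqr_ge0 //.
apply: le_trans (cauchy_schwarz _ _) _.
by rewrite -[leRHS]mul1r ler_pM // sqn_ge0.
Qed.

(** The form in which the property is used: a functional of finite rank with an
    evident bound on its norm must be a vector functional. *)
Lemma property_A11_finite_rank m u v (a : nat -> R) B : property_A11 B ->
  (forall k, (k < m)%N -> sqn (u k) <= 1) ->
  (forall k, (k < m)%N -> 0 <= a k /\ sqn (v k) <= a k ^+ 2) ->
  \sum_(k < m) a k < 1 ->
  exists xi eta : H, [/\ sqn xi < 1, sqn eta < 1 &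
    forall T, B T -> \sum_(k < m) inner (T (u k)) (v k) = inner (T xi) eta].
Proof.
move=> A11 u1 va a1.
have [xi [eta [xi1 eta1 h]]] := A11 _ (@finite_rank_linear m u v B)
  (@finite_rank_continuous m u v B) (@finite_rank_norm_lt1 m u v a B u1 va a1).
by exists xi, eta; split=> //; rewrite -hnorm_sqr expr_lt1 // sqrtr_ge0.
Qed.

End FiniteRank.

(** * Matrix units *)

Section Matrices.
Variables (R : realType) (H : hilbert R) (n : nat).
Local Notation C := R[i].
Implicit Types (x y : dsum H n) (f g : H).

Definition dvec (i : 'I_n) f : dsum H n := [ffun j => if j == i then f else 0].

Lemma inner_dvec x i f : inner x (dvec i f) = inner (x i) f.
Proof.
rewrite dsum_innerE (bigD1 i) //= ffunE eqxx big1 ?addr0 // => j ji.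
by rewrite ffunE (negbTE ji) ip0r.
Qed.

Lemma sqn_dsum x : sqn x = \sum_i sqn (x i).
Proof. by rewrite /sqn dsum_innerE raddf_sum. Qed.

Lemma sqn_dvec i f : sqn (dvec i f) = sqn f.
Proof. by rewrite {1}/sqn inner_dvec ffunE eqxx. Qed.

Lemma inner_mx_op (b : 'M[H -> H]_n) x y :
  inner (mx_op b x : dsum H n) y = \sum_i \sum_j inner (b i j (x j)) (y i).
Proof.
rewrite dsum_innerE; apply: eq_bigr => i _.
by rewrite ffunE linear_sumlz.
Qed.

Definition mx_unit (i j : 'I_n) (T : H -> H) : 'M[H -> H]_n :=
  \matrix_(k, l) if (k == i) && (l == j) then T else 0.

Lemma mx_unit_algebra (A : set (H -> H)) i j T : A 0 -> A T ->
  mx_algebra n A (mx_op (mx_unit i j T)).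
Proof. by move=> A0 AT; exists (mx_unit i j T) => //= k l; rewrite mxE; case: ifP. Qed.

Lemma inner_mx_unit i j T x y :
  inner (mx_op (mx_unit i j T) x : dsum H n) y = inner (T (x j)) (y i).
Proof.
rewrite inner_mx_op (bigD1 i) //= (bigD1 j) //= mxE !eqxx /=.
rewrite [X in _ + X + _]big1 ?addr0; last first.
  by move=> l lj; rewrite mxE eqxx (negbTE lj) /= ip0l.
rewrite big1 ?addr0 // => k ki; rewrite big1 // => l _.
by rewrite mxE (negbTE ki) /= ip0l.
Qed.

End Matrices.

(** * Multipliers, and the trace at the origin *)

Section Multipliers.
Variables (R : realType) (d : nat) (H : drury_arveson R d).
Local Notation C := R[i].
Local Notation ball := (unit_ball R d).
Local Notation ev := (@rkhs_eval R ball _ H).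
Local Notation k0 := (@rkhs_kernel R ball _ H (origin R d)).

Lemma multiplier0 : multiplier_algebra H 0.
Proof.
split; last by exists (fun=> 0) => f x; rewrite mul0r ev0.
split; first by move=> a f g; rewrite scaler0 addr0.
by exists 0 => f; rewrite mul0r hnormE sqn0 sqrtr0.
Qed.

(** Vectors with a single nonzero coordinate keep this shape only because
    operators vanish at 0, which a map [H -> H] need not do. *)
Lemma multiplier_map0 T : multiplier_algebra H T -> T 0 = 0.
Proof. by case=> -[+ _] _ => /(_ (-1) 0 0); rewrite scaler0 addr0 scaleN1r addNr. Qed.

Lemma sqn_iter_mulz_le i k f : sqn (iter k (@mulz _ _ H i) f) <= sqn f.
Proof. by elim: k => //= k; apply: le_trans; exact: sqn_mulz_le. Qed.

Lemma ev_iter_mulz i k f w :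
  ev (iter k (@mulz _ _ H i) f) w = sval w 0 i ^+ k * ev f w.
Proof.
by elim: k => [|k IHk]; rewrite ?mul1r //= ev_mulz IHk exprS mulrA.
Qed.

Lemma multiplier_iter_mulz i k : multiplier_algebra H (iter k (@mulz _ _ H i)).
Proof.
split; last by exists (fun w : ball => sval w 0 i ^+ k) => f w; rewrite ev_iter_mulz.
split.
  by move=> a f g; elim: k => //= k ->; rewrite mulz_linear.
by exists 1 => f; rewrite mul1r !hnormE ler_sqrt ?sqn_ge0 // sqn_iter_mulz_le.
Qed.

Lemma multiplier_id : multiplier_algebra H id.
Proof.
split; last by exists (fun=> 1) => f w; rewrite mul1r.
by split=> //; exists 1 => f; rewrite mul1r.
Qed.

Lemma inord_eq n (j k : nat) : (j <= n)%N -> (k <= n)%N ->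
  ((inord j : 'I_n.+1) == inord k) = (j == k).
Proof. by move=> jn kn; rewrite -val_eqE /= !inordK. Qed.

(** The functional [b |-> (b_00(0) + b_11(0)) / 4] has norm at most 1/2; here
    [x j] and [y i] are the coordinates of the two vectors that represent it. *)
Lemma property_A11_trace : property_A11 (mx_algebra 6 (multiplier_algebra H)) ->
  exists x y : nat -> H, forall i j T, (i < 2)%N -> (j < 2)%N ->
    multiplier_algebra H T ->
    inner (T (x j)) (y i) = if i == j then 4^-1 * ev (T k0) (origin R d) else 0.
Proof.
pose u k : dsum H 6 := dvec (inord k) k0.
pose v k : dsum H 6 := dvec (inord k) ((4^-1 : R)%:C%C *: k0).
move=> /(@property_A11_finite_rank _ _ 2 u v (fun=> 4^-1)) [k _|k _||].
- by rewrite sqn_dvec sqn_ker0.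
- by rewrite sqn_dvec sqnZ sqn_ker0 nsq_real mulr1 invr_ge0 ler0n.
- by rewrite !big_ord_recl big_ord0 /=; lra.
move=> xi [eta [_ _ h]].
exists (fun k => xi (inord k)), (fun k => eta (inord k)) => i j T i2 j2 MT.
have := h _ (mx_unit_algebra (inord i) (inord j) multiplier0 MT).
rewrite inner_mx_unit => <-.
have lt6 k : (k < 2)%N -> (k <= 5)%N by case: k => [|[|]].
have term (k : 'I_2) : inner (mx_op (mx_unit (inord i) (inord j) T) (u k) : dsum H 6) (v k)
    = if (i == k) && (j == k) then 4^-1 * ev (T k0) (origin R d) else 0.
  rewrite inner_mx_unit !ffunE !inord_eq ?lt6 //.
  case: (i == k); last by rewrite ip0r.
  case: (j == k); last by rewrite multiplier_map0 // ip0l.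
  by rewrite ipZr -ev_inner conjC_real fmorphV rmorph_nat.
rewrite (eq_bigr _ (fun k _ => term k)) !big_ord_recl big_ord0 /=.
by case: i i2 j j2 {h term lt6} => [|[|]] // _ [|[|]] // _; rewrite ?addr0 ?add0r.
Qed.

End Multipliers.

(** * Dimension zero *)

Section DimensionZero.
Variables (R : realType) (H : drury_arveson R 0).

Lemma not_property_A11_dim0 : ~ property_A11 (mx_algebra 6 (multiplier_algebra H)).
Proof.
move=> /property_A11_trace [x [y h]].
set k0 := rkhs_kernel H (origin R 0) in h.
have rank1 i j : inner (x j) (y i) =
    rkhs_eval (x j) (origin R 0) * (rkhs_eval (y i) (origin R 0))^*.
  by rewrite {1}[x j]gleasonE big_ord0 addr0 ipZl inner_ker_l.
have e i j : (i < 2)%N -> (j < 2)%N ->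
    inner (x j) (y i) = if i == j then 4^-1 else 0.
  move=> i2 j2; rewrite (h i j id) ?ev_ker0 ?mulr1 //; exact: multiplier_id.
have : inner (x 0%N) (y 0%N) * inner (x 1%N) (y 1%N) =
    inner (x 0%N) (y 1%N) * inner (x 1%N) (y 0%N) by rewrite !rank1; ring.
rewrite !e //= mul0r => /eqP; rewrite mulf_eq0 orbb invr_eq0.
by rewrite pnatr_eq0.
Qed.

End DimensionZero.

(** * Dimension one: wandering vectors in the Hardy space *)

Section DimensionOne.
Variables (R : realType) (H : drury_arveson R 1).
Local Notation C := R[i].
Local Notation ball := (unit_ball R 1).
Local Notation ev := (@rkhs_eval R ball _ H).
Local Notation ker := (@rkhs_kernel R ball _ H).
Local Notation o := (origin R 1).
Local Notation k0 := (ker o).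
Local Notation t := (@mulz R 1 H ord0).
Local Notation s := (@adjz R 1 H ord0).
Local Notation "'t^' k" := (iter k t) (at level 3, k at level 2).
Implicit Types (f g x y : H) (w : ball).

Lemma gleason1 f w : ev f w = ev f o + sval w 0 ord0 * ev (s f) w.
Proof. by rewrite gleason big_ord1. Qed.

Lemma nsq_coord_lt1 w : nsq (sval w 0 ord0) < 1.
Proof. by have := svalP w; rewrite big_ord1 normCK mul_conj_nsq (ltcR _ 1). Qed.

(** A function [f] in the kernel vanishes off the origin.  If [f(0) = c] is
    nonzero, then [f = c + z (S f)] forces [S f = - c / z] off the origin, which
    contradicts the bound [|S f (w)|^2 <= |S f|^2 / (1 - |w|^2)] near 0. *)
Lemma mulz_inj f : t f = 0 -> f = 0.
Proof.
move=> tf; have off w : sval w 0 ord0 != 0 -> ev f w = 0.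
  move=> w0; have := ev_mulz ord0 f w; rewrite tf ev0 => /esym/eqP.
  by rewrite mulf_eq0 (negbTE w0) => /eqP.
suff f0 : ev f o = 0.
  apply: ev_ext => w; rewrite ev0; have [w0|/off//] := eqVneq (sval w 0 ord0) 0.
  by rewrite gleason1 w0 mul0r addr0.
apply/eqP; apply: contraT => f0.
have c0 : 0 < nsq (ev f o).
  by rewrite lt_neqAle nsq_ge0 andbT eq_sym; apply: contra_neq f0; exact: nsq_eq0.
have cf : nsq (ev f o) <= sqn f.
  by have := nsq_ev_le f o; rewrite sqn_ker0 mulr1.
pose q := nsq (ev f o) / (2 * (sqn f + nsq (ev f o))).
have D0 : 0 < 2 * (sqn f + nsq (ev f o)) by lra.
have q0 : 0 < q by rewrite divr_gt0.
have qD : q * (2 * (sqn f + nsq (ev f o))) = nsq (ev f o).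
  by rewrite divfK // gt_eqF.
have q1 : q < 1 by rewrite ltr_pdivrMr // mul1r; lra.
pose r := Num.sqrt q; have r2 : r ^+ 2 = q by rewrite sqr_sqrtr // ltW.
have [|w /(_ ord0) wE] := @axis_point R 1 ord0 r; first by rewrite r2.
rewrite eqxx in wE.
have rq : nsq r%:C%C = q by rewrite nsq_real.
have w0 : sval w 0 ord0 != 0.
  by apply/eqP => w0; move: rq q0; rewrite -wE w0 nsq_real expr0n => <-; rewrite ltxx.
have : nsq (ev f o) <= q * (sqn f * (1 - q)^-1).
  have -> : nsq (ev f o) = q * nsq (ev (s f) w).
    have := gleason1 f w; rewrite off // => /esym/eqP; rewrite addr_eq0 => /eqP ->.
    rewrite -rq -wE -nsqM /nsq; case: (_ * _) => a b /=; ring.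
  rewrite ler_pM2l //; apply: le_trans (nsq_ev_le _ _) _.
  rewrite sqn_ker big_ord1 wE rq ler_wpM2r ?invr_ge0 ?subr_ge0 ?(ltW q1) //.
  exact: sqn_adjz_le.
rewrite mulrA ler_pdivlMr ?subr_gt0 //.
move: qD c0; move: (nsq _) (sqn f) => N S; nra.
Qed.

(** [T f] vanishes at 0, so [T f = T S T f], and T is injective. *)
Lemma adjzK f : s (t f) = f.
Proof.
apply/eqP; rewrite -subr_eq0; apply/eqP; apply: mulz_inj.
rewrite mulzB; apply/eqP; rewrite subr_eq0; apply/eqP; apply: ev_ext => w.
by rewrite ev_mulz [RHS]gleason1 ev_mulz originE mul0r add0r.
Qed.

Lemma inner_mulz_mulz f g : inner (t f) (t g) = inner f g.
Proof. by rewrite inner_mulz adjzK. Qed.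

Lemma inner_iter_iter k f g : inner (t^k f) (t^k g) = inner f g.
Proof. by elim: k => //= k IHk; rewrite inner_mulz_mulz. Qed.

Lemma inner_iter_adjz k f g : inner f (t^k g) = inner (iter k s f) g.
Proof. by elim: k f => //= k IHk f; rewrite -inner_adjz IHk -iterSr. Qed.

(** A function orthogonal to all monomials is divisible by every power of z:
    [f = z^k S^k f], where [|S^k f| <= |f|], so [f(w)] is bounded by a multiple of
    [|w|^k]. *)
Lemma monomials_total f : (forall k, inner f (t^k k0) = 0) -> f = 0.
Proof.
move=> f0; apply: ev_ext => w; rewrite ev0.
have fk k : ev f w = sval w 0 ord0 ^+ k * ev (iter k s f) w.
  elim: k => [|k ->]; first by rewrite mul1r.
  rewrite gleason1 ev_inner -inner_iter_adjz f0 add0r exprSr mulrA.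
  by [].
have sk k : sqn (iter k s f) <= sqn f.
  by elim: k => //= k; apply: le_trans; exact: sqn_adjz_le.
set a := nsq (sval w 0 ord0) in fk *.
have nsqX k : nsq (sval w 0 ord0 ^+ k) = a ^+ k.
  elim: k => [|k IHk]; first by rewrite !expr0 /nsq /= expr0n expr1n addr0.
  by rewrite !exprS nsqM IHk.
have le k : nsq (ev f w) <= a ^+ k * (sqn f * sqn (ker w)).
  rewrite (fk k) nsqM nsqX ler_wpM2l ?exprn_ge0 ?nsq_ge0 //.
  by apply: le_trans (nsq_ev_le _ _) _; rewrite ler_wpM2r ?sqn_ge0.
apply: nsq_eq0; apply/le_anti; rewrite nsq_ge0 andbT.
have lim0 : a ^+ k * (sqn f * sqn (ker w)) @[k --> \oo] --> (0 : R).
  rewrite -(mul0r (sqn f * sqn (ker w))); apply: cvgM; last exact: cvg_cst.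
  by apply: cvg_expr; rewrite ger0_norm ?nsq_ge0 ?nsq_coord_lt1.
rewrite -(cvg_lim _ lim0) //; apply: limr_ge; first by apply/cvg_ex; exists 0.
by near=> k; exact: le.
Unshelve. all: by end_near.
Qed.

(** Up to a scalar factor, these are the inner functions. *)
Definition wandering x := forall k, inner (t^k.+1 x) x = 0.

Lemma inner_wandering x m k : wandering x ->
  inner (t^m x) (t^k x) = if m == k then (sqn x)%:C%C else 0.
Proof.
move=> xw; have gt p q : inner (t^(p.+1 + q) x) (t^q x) = 0.
  by rewrite addnC iterD inner_iter_iter.
case: ltngtP => [mk|km|->]; last by rewrite inner_iter_iter ipxx.
  by rewrite ipC -(subnK mk) -addSnnS gt rmorph0.
by rewrite -(subnK km) -addSnnS gt.
Qed.

Lemma wandering_k0 : wandering k0.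
Proof. by move=> k; rewrite -ev_inner ev_iter_mulz originE expr0n mul0r. Qed.

Definition dpair x y : dsum H 2 := [ffun k => if k == ord0 then x else y].

Lemma inner_dpair (v : dsum H 2) x y :
  inner v (dpair x y) = inner (v ord0) x + inner (v (lift ord0 ord0)) y.
Proof. by rewrite dsum_innerE big_ord_recl big_ord1 !ffunE. Qed.

(** Since [p |-> x p] is a multiple of an isometry on polynomials, multiplication
    by [x] should be defined everywhere.  Project [(0, y)] onto the subspace of
    pairs [(u, v)] with [u = x v] that satisfy the relations which the pairs
    [(x z^m, z^m)] satisfy.  Testing the projection [(u, v)] against these pairs
    gives [y = (1 + |x|^2) v], so that [(1 + |x|^2) u] is the product. *)
Lemma wandering_product x y : wandering x ->
  (forall k l, inner (t^k x) (t^l y) = 0) ->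
  exists h, [/\ forall w, ev h w = ev x w * ev y w,
    forall k, inner h (t^k x) = (sqn x)%:C%C * inner y (t^k k0) &
    forall k, inner h (t^k y) = 0].
Proof.
move=> xw xy; set c := (sqn x)%:C%C.
have cR : c^* = c by exact: conjC_real.
pose G (v : dsum H 2) := [\/ exists w, v = dpair (ker w) (- (ev x w)^* *: ker w),
  exists k, v = dpair (t^k x) (- c *: t^k k0) | exists k, v = dpair (t^k y) 0].
have GP v : annihilator G v <-> [/\ forall w, ev (v ord0) w = ev x w * ev (v (lift ord0 ord0)) w,
    forall k, inner (v ord0) (t^k x) = c * inner (v (lift ord0 ord0)) (t^k k0) &
    forall k, inner (v ord0) (t^k y) = 0].
  split=> [vG|[v1 v2 v3] _ [[w ->]|[k ->]|[k ->]]]; rewrite ?inner_dpair.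
  - split=> [w|k|k].
    + have := vG (dpair (ker w) (- (ev x w)^* *: ker w)).
      rewrite inner_dpair ipZr rmorphN /= conjCK -!ev_inner mulNr => /(_ _)/eqP.
      by rewrite subr_eq0 => h; apply/eqP; apply: h; constructor 1; exists w.
    + have := vG (dpair (t^k x) (- c *: t^k k0)).
      rewrite inner_dpair ipZr rmorphN /= cR mulNr => /(_ _)/eqP.
      by rewrite subr_eq0 => h; apply/eqP; apply: h; constructor 2; exists k.
    + have := vG (dpair (t^k y) 0); rewrite inner_dpair ip0r addr0; apply.
      by constructor 3; exists k.
  - by rewrite ipZr rmorphN /= conjCK -!ev_inner v1 mulNr subrr.
  - by rewrite ipZr rmorphN /= cR v2 mulNr subrr.
  - by rewrite ip0r addr0.
have gen m : annihilator G (dpair (t^m x) (t^m k0)).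
  apply/GP; rewrite !ffunE /=; split=> [w|k|k].
  - by rewrite !ev_iter_mulz ev_ker0 mulr1 mulrC.
  - rewrite !inner_wandering //; last exact: wandering_k0.
    by case: eqP; rewrite ?mulr0 // sqn_ker0 mulr1.
  - exact: xy.
have [p /GP[p1 p2 p3] pP] := @orthogonal_projection _ _ G (dpair 0 y).
set u := p ord0 in p1 p2 p3; set v := p (lift ord0 ord0) in p1 p2.
have yE : y = (1 + c) *: v.
  apply/eqP; rewrite -subr_eq0; apply/eqP; apply: monomials_total => k.
  have := pP _ (gen k); rewrite inner_dpair !ffunE /= ipBl ip0l sub0r p2 -/v.
  by move=> hk; rewrite -[RHS]hk !ipBl ipZl; ring.
exists ((1 + c) *: u); split=> [w|k|k].
- by rewrite evZ p1 yE evZ mulrCA.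
- by rewrite ipZl p2 yE ipZl mulrCA.
- by rewrite ipZl p3 mulr0.
Qed.

(** The product [x y] is orthogonal to every [T^k y], as a member of the subspace
    generated by [x]; as [y x], it pairs with [T^k y] as [x] does with
    [|y|^2 z^k].  So [y] vanishes or [x] is orthogonal to all monomials. *)
Lemma wandering_dim1 x y : wandering x -> wandering y ->
  (forall k l, inner (t^k x) (t^l y) = 0) -> x = 0 \/ y = 0.
Proof.
move=> xw yw xy; have yx k l : inner (t^k y) (t^l x) = 0.
  by rewrite ipC xy rmorph0.
have [h [hE _ hy]] := wandering_product xw xy.
have [h' [h'E h'y _]] := wandering_product yw yx.
have hh' : h' = h by apply: ev_ext => w; rewrite hE h'E mulrC.
have [y0|y0] := eqVneq (sqn y) 0; first by right; exact: sqn_eq0.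
left; apply: monomials_total => k; apply/eqP.
have /esym/eqP := h'y k; rewrite hh' hy mulf_eq0 => /orP[/eqP e|//].
by move: y0; rewrite -[sqn y]/(complex.Re (sqn y)%:C%C) e eqxx.
Qed.

Lemma not_property_A11_dim1 : ~ property_A11 (mx_algebra 6 (multiplier_algebra H)).
Proof.
move=> /property_A11_trace [x [y h]].
have xyE i j k : (i < 2)%N -> (j < 2)%N ->
    inner (t^k (x j)) (y i) = if (i == j) && (k == 0%N) then 4^-1 else 0.
  move=> i2 j2; rewrite h //; last exact: multiplier_iter_mulz.
  rewrite ev_iter_mulz originE ev_ker0 expr0n mulr1.
  by case: (i == j); case: (k == 0%N); rewrite ?mulr1 ?mulr0.
(* [Q] is the orthogonal complement of the invariant subspace generated by [x]. *)
pose Q := annihilator (fun f => exists k j, (j < 2)%N /\ f = t^k (x j)).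
have Qs f : Q f -> Q (s f).
  move=> Qf _ [k [j [j2 ->]]]; rewrite inner_adjz; apply: Qf.
  by exists k.+1, j.
have Qy i : (i < 2)%N -> Q (s (y i)).
  move=> i2 _ [k [j [j2 ->]]]; rewrite inner_adjz ipC -[t _]/(t^k.+1 _).
  by rewrite xyE // andbF rmorph0.
(* [E] is the wandering subspace: membership in the complement of [Q], and
   orthogonality to its image under [t], which is [Q (s f)]. *)
pose E f := (forall q, Q q -> inner f q = 0) /\ Q (s f).
have Ew f g k : E f -> E g -> inner (t^k.+1 f) g = 0.
  move=> [fQ _] [_ gQ]; rewrite /= inner_mulz.
  have {gQ} : Q (s g) by []; move: (s g) => q; elim: k q => /= [|k IHk] q Qq.
    exact: fQ.
  by rewrite inner_mulz; apply: IHk; exact: Qs.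
have El a f g : E f -> E g -> E (a *: f + g).
  move=> [f1 f2] [g1 g2]; split; last by rewrite adjz_linear; exact: annihilator_lin.
  by move=> q Qq; rewrite ipDl ipZl f1 // g1 // mulr0 addr0.
have proj i : (i < 2)%N -> exists2 e, E e &
    forall j, (j < 2)%N -> inner e (x j) = if i == j then 4^-1 else 0.
  move=> i2.
  have [q Qq qP] := orthogonal_projection
    (fun f => exists k j, (j < 2)%N /\ f = t^k (x j)) (y i).
  exists (y i - q).
    split=> //; rewrite adjzB addrC -scaleN1r.
    by apply: annihilator_lin; [exact: Qs | exact: Qy].
  move=> j j2; rewrite ipBl (Qq (x j)); last by exists 0%N, j.
  rewrite subr0 ipC -[x j]/(t^0 (x j)) xyE // andbT.
  by case: (i == j); rewrite ?rmorph0 // fmorphV rmorph_nat.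
have [e0 E0 e0x] := proj 0%N isT; have [e1 E1 e1x] := proj 1%N isT.
have four : (4^-1 : C) <> 0 by apply/eqP; rewrite invr_eq0 pnatr_eq0.
have e0n : e0 != 0.
  by apply/eqP => e00; apply: four; have := e0x 0%N isT; rewrite e00 ip0l.
have n0 : (sqn e0)%:C%C != 0.
  by apply/eqP => -[/sqn_eq0 e00]; move: e0n; rewrite e00 eqxx.
(* One Gram-Schmidt step. *)
pose a := inner e1 e0 / (sqn e0)%:C%C.
pose e := - a *: e0 + e1.
have Ee : E e by exact: El.
have ee0 : inner e e0 = 0.
  by rewrite ipDl ipZl ipxx /a mulNr divfK // addNr.
have [||m n|e00|e00] := @wandering_dim1 e0 e.
- by move=> k; exact: Ew.
- by move=> k; exact: Ew.
- case: (leqP m n) => mn.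
    rewrite -(subnK mn) addnC iterD inner_iter_iter.
    case: (n - m)%N => [|k]; first by rewrite /= ipC ee0 rmorph0.
    by rewrite ipC Ew // rmorph0.
  rewrite -(subnK mn) -addSnnS addnC iterD inner_iter_iter; exact: Ew.
- by move: e0n; rewrite e00 eqxx.
apply: four; have := e1x 1%N isT; rewrite /= => <-.
have : inner e (x 1%N) = 0 by rewrite e00 ip0l.
by rewrite ipDl ipZl e0x // mulr0 add0r.
Qed.

End DimensionOne.

(** * Dimension at least two: the column of two coordinates *)

Section DimensionAtLeastTwo.
Variables (R : realType) (d : nat) (H : drury_arveson R d).
Local Notation C := R[i].
Local Notation Re := complex.Re.
Local Notation ball := (unit_ball R d).
Local Notation ev := (@rkhs_eval R ball _ H).
Local Notation ker := (@rkhs_kernel R ball _ H).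
Local Notation o := (origin R d).
Local Notation k0 := (ker o).
Implicit Types (f g : H) (w : ball) (i l : 'I_d).

(** For the lower bound, [z_i] is orthogonal to the constants, so
    [|w_i|^2 = |<z_i, ker w - 1>|^2 <= |z_i|^2 (|ker w|^2 - 1)]; at a point with
    [|w_i|^2 = e] on the i-th axis this reads [1 - e <= |z_i|^2]. *)
Lemma sqn_mulz_k0 i : sqn (mulz i k0) = 1.
Proof.
apply/le_anti/andP; split; first by rewrite -[leRHS](sqn_ker0 H) sqn_mulz_le.
apply/ler_addgt0Pr => e e0.
have [e1|e1] := leP 1 e; first by apply: le_trans e1 _; rewrite lerDr sqn_ge0.
pose r := Num.sqrt e; have r2 : r ^+ 2 = e by rewrite sqr_sqrtr // ltW.
have [|w wE] := @axis_point R d i r; first by rewrite r2.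
have := cauchy_schwarz (mulz i k0) (ker w - k0).
rewrite ipBr -!ev_inner !ev_mulz !ev_ker0 !mulr1 wE eqxx originE subr0 nsq_real r2.
have -> : sqn (ker w - k0) = e / (1 - e).
  rewrite sqnB sqn_ker0 -ev_inner -/k0 sqn_ker (bigD1 i) //= wE eqxx nsq_real r2.
  rewrite big1 ?addr0; last by move=> l li; rewrite wE (negbTE li) nsq_real expr0n.
  have -> : ev (ker w) o = 1.
    by rewrite ev_inner ipC -ev_inner ev_ker0 rmorph1.
  by rewrite /=; field; rewrite subr_eq0 gt_eqF.
rewrite mulrCA -{1}[e]mulr1 ler_pM2l // ler_pdivlMr ?subr_gt0 // mul1r.
by rewrite lerBlDr addrC.
Qed.

Lemma adjz_mulz_close i f : sqn (adjz i (mulz i f) - f) <= sqn f - sqn (mulz i f).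
Proof.
rewrite sqnB inner_adjz -/(sqn (mulz i f)).
have := sqn_adjz_le i (mulz i f); lra.
Qed.

(** The squared norms [|S_l T_i f|^2] sum to at most [|T_i f|^2], and the term at
    [l = i] already exhausts this up to [|f|^2 - |T_i f|^2]. *)
Lemma cross_adjz_mulz i f :
  \sum_(l | l != i) sqn (adjz l (mulz i f)) <= sqn f - sqn (mulz i f).
Proof.
have := sqn_adjz_sum_le (mulz i f); rewrite (bigD1 i) //=.
have := sqn_ge0 (adjz i (mulz i f) - f).
rewrite sqnB inner_adjz -/(sqn (mulz i f)); lra.
Qed.

Lemma sqnD_le (x y : H) : sqn (x + y) <= 2 * sqn x + 2 * sqn y.
Proof. by have := sqn_ge0 (x - y); rewrite sqnB sqnD; lra. Qed.

(** If T_i almost preserves the norm of [f], then [S_i T_i f] is close to [f], so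
    [S_l f] is close to [S_l S_i T_i f = S_i (S_l T_i f)], which is small. *)
Lemma other_adjz i f :
  \sum_(l | l != i) sqn (adjz l f) <= 4 * (sqn f - sqn (mulz i f)).
Proof.
pose g := adjz i (mulz i f).
have le l : sqn (adjz l f) <=
    2 * sqn (adjz l (mulz i f)) + 2 * sqn (adjz l (g - f)).
  have -> : adjz l f = adjz l g - adjz l (g - f).
    by rewrite -adjzB opprB addrC subrK.
  apply: le_trans (sqnD_le _ _) _; rewrite sqnN lerD2r ler_pM2l //.
  by rewrite /g adjzC sqn_adjz_le.
apply: le_trans (ler_sum _ (fun l _ => le l)) _.
rewrite big_split /= -!mulr_sumr.
have := cross_adjz_mulz i f.
have : \sum_(l | l != i) sqn (adjz l (g - f)) <= sqn f - sqn (mulz i f).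
  apply: le_trans (adjz_mulz_close i f).
  apply: le_trans (sqn_adjz_sum_le _).
  rewrite [leRHS](bigD1 i) //= lerDr; exact: sqn_ge0.
lra.
Qed.

(** [|f - f(0)|^2] is the sum of all [|S_j f|^2]; since [i != l], each index [j]
    differs from [i] or from [l], and [other_adjz] applies to it. *)
Lemma near_constant i l f : i != l ->
  sqn (f - ev f o *: k0) <=
    4 * ((sqn f - sqn (mulz i f)) + (sqn f - sqn (mulz l f))).
Proof.
move=> il.
have -> : sqn (f - ev f o *: k0) = \sum_j sqn (adjz j f).
  rewrite sqnB sqnZ sqn_ker0 ipZr -ev_inner [_^* * _]mulrC mul_conj_nsq /=.
  by rewrite [sqn f]sqn_gleason; ring.
rewrite mulrDr (bigD1 i) //=; apply: le_trans (lerD (other_adjz i f) (other_adjz l f)).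
rewrite addrC lerD2l (bigD1 i) //= lerDl.
by apply: sumr_ge0 => j _; exact: sqn_ge0.
Qed.

(** Comparison of the two sides of
    [(c0 d0) (c1 d1) = (c0 d1) (c1 d0)]. *)
Lemma rank_one_far_from_diag (c0 c1 d0 d1 : C) :
  let s : C := ((353 / 1000 : R)%:C)%C in let e : R := 27 / 1000 in
  nsq (s - c0 * d0) <= e -> nsq (s - c1 * d1) <= e ->
  nsq (c0 * d1) <= e -> nsq (c1 * d0) <= e -> False.
Proof.
move=> s e; have diag (z : C) : nsq (s - z) <= e -> 35 / 1000 <= nsq z.
  rewrite /nsq /s /e; case: z => a b /=; have := sqr_ge0 b.
  have := sqr_ge0 (0 - b); nra.
move=> /diag h0 /diag h1 h2 h3.
have : nsq (c0 * d0) * nsq (c1 * d1) = nsq (c0 * d1) * nsq (c1 * d0).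
  by rewrite !nsqM; ring.
have := nsq_ge0 (c0 * d1); have := nsq_ge0 (c1 * d0).
move: h0 h1 h2 h3; rewrite /e; move: (nsq _) (nsq _) (nsq _) (nsq _).
move=> a b c f; nra.
Qed.

(** The vectors [v k] below have squared norm [2 s^2] with [s = 353/1000], less
    than [(999/2000)^2], so that the two summands of the functional have norm sum
    below 1.  The coordinates of the representing vectors are [x j], and [y1 i]
    and [y2 i] in the positions i and i + 2. *)
Lemma property_A11_column i1 i2 : property_A11 (mx_algebra 6 (multiplier_algebra H)) ->
  exists x y1 y2 : nat -> H,
  [/\ sqn (x 0%N) + sqn (x 1%N) <= 1,
      sqn (y1 0%N) + sqn (y1 1%N) + sqn (y2 0%N) + sqn (y2 1%N) <= 1,
      forall (i j : nat) T, (i < 2)%N -> (j < 2)%N -> multiplier_algebra H T ->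
      inner (T (x j)) (y1 i) =
        if i == j then (353 / 1000 : R)%:C%C * inner (T k0) (mulz i1 k0) else 0 &
      forall (i j : nat) T, (i < 2)%N -> (j < 2)%N -> multiplier_algebra H T ->
      inner (T (x j)) (y2 i) =
        if i == j then (353 / 1000 : R)%:C%C * inner (T k0) (mulz i2 k0) else 0].
Proof.
pose s : R := 353 / 1000.
pose z1 := s%:C%C *: mulz i1 k0; pose z2 := s%:C%C *: mulz i2 k0.
pose u k : dsum H 6 := dvec (inord k) k0.
pose v k : dsum H 6 := dvec (inord k) z1 + dvec (inord k.+2) z2.
have lt6 k : (k < 2)%N -> (k <= 5)%N by case: k => [|[|]].
have lt6' k : (k < 2)%N -> (k.+2 <= 5)%N by case: k => [|[|]].
move=> /(@property_A11_finite_rank _ _ 2 u v (fun=> 999 / 2000)) [k _|k k2||].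
- by rewrite sqn_dvec sqn_ker0.
- split; first lra.
  rewrite sqnD !sqn_dvec inner_dvec ffunE inord_eq ?(lt6 _ k2) ?(lt6' _ k2) //.
  rewrite ifF; last by case: k k2 => [|[|]].
  by rewrite ip0l !sqnZ !sqn_mulz_k0 !nsq_real /= /s; lra.
- by rewrite !big_ord_recl big_ord0 /=; lra.
move=> xi [eta [xi1 eta1 h]].
exists (fun k => xi (inord k)), (fun k => eta (inord k)), (fun k => eta (inord k.+2)).
have coords (a : dsum H 6) : sqn a =
    sqn (a (inord 0)) + sqn (a (inord 1)) + sqn (a (inord 2)) + sqn (a (inord 3))
    + sqn (a (inord 4)) + sqn (a (inord 5)).
  rewrite sqn_dsum !big_ord_recr big_ord0 /= add0r.
  by do ![congr (_ + _)]; congr (sqn (a _)); apply/val_inj; rewrite /= inordK.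
have nn (a : dsum H 6) k := sqn_ge0 (a (inord k)).
split.
- move: xi1; rewrite coords.
  have := nn xi 2; have := nn xi 3; have := nn xi 4; have := nn xi 5; lra.
- move: eta1; rewrite coords.
  have := nn eta 4; have := nn eta 5; lra.
- move=> i j T ilt j2 MT.
  have := h _ (mx_unit_algebra (inord i) (inord j) (@multiplier0 _ _ H) MT).
  rewrite inner_mx_unit => <-; rewrite !big_ord_recl big_ord0 !inner_mx_unit.
  rewrite !ffunE.
  case: i ilt j j2 {h} => [|[|]] // _ [|[|]] // _;
    rewrite !inord_eq //= ?(multiplier_map0 MT) ?ip0l ?addr0 ?add0r ?ip0r ?ipZr ?conjC_real ?addr0 //.
- move=> i j T ilt j2 MT.
  have := h _ (mx_unit_algebra (inord i.+2) (inord j) (@multiplier0 _ _ H) MT).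
  rewrite inner_mx_unit => <-; rewrite !big_ord_recl big_ord0 !inner_mx_unit.
  rewrite !ffunE.
  case: i ilt j j2 {h} => [|[|]] // _ [|[|]] // _;
    rewrite !inord_eq //= ?(multiplier_map0 MT) ?ip0l ?addr0 ?add0r ?ip0r ?ipZr ?conjC_real ?addr0 //.
Qed.

(** Each of the four values [s] of the functional at z_1 and z_2 is an inner product
    [<T x_j, y>]; adding the bounds [2 s <= (7/10) |T x_j|^2 + (10/7) |y|^2], where
    7/10 is close to [1 / sqrt 2], shows that the four numbers [|T x_j|^2] sum to
    more than [2 - 27/4000].  So [near_constant] leaves a squared error of at most
    27/1000. *)
Lemma not_property_A11_dim_ge2 i1 i2 : i1 != i2 ->
  ~ property_A11 (mx_algebra 6 (multiplier_algebra H)).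
Proof.
move=> i12 /(property_A11_column i1 i2) [x [y1 [y2 [x1 y12 h1 h2]]]].
set s := (353 / 1000 : R)%:C%C in h1 h2.
have M i : multiplier_algebra H (mulz i) := multiplier_iter_mulz H i 1.
have e1 (i j : nat) : (i < 2)%N -> (j < 2)%N ->
    inner (mulz i1 (x j)) (y1 i) = if i == j then s else 0.
  by move=> ilt j2; rewrite h1 // ipxx sqn_mulz_k0 rmorph1 mulr1.
have e2 (i j : nat) : (i < 2)%N -> (j < 2)%N ->
    inner (mulz i2 (x j)) (y2 i) = if i == j then s else 0.
  by move=> ilt j2; rewrite h2 // ipxx sqn_mulz_k0 rmorph1 mulr1.
have y1le (i : nat) : (i < 2)%N -> sqn (y1 i) <= 1.
  have := sqn_ge0 (y1 0%N); have := sqn_ge0 (y1 1%N).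
  have := sqn_ge0 (y2 0%N); have := sqn_ge0 (y2 1%N).
  by case: i => [|[|]] // *; lra.
have amgm (a b : H) : inner a b = s -> 2 * (353 / 1000) <= 7 / 10 * sqn a + 10 / 7 * sqn b.
  move=> ab; have := sqn_ge0 ((7 / 10 : R)%:C%C *: a - b).
  rewrite sqnB sqnZ nsq_real ipZl ab /s -rmorphM /=; lra.
have g00 := amgm _ _ (e1 0%N 0%N isT isT); have g11 := amgm _ _ (e1 1%N 1%N isT isT).
have g20 := amgm _ _ (e2 0%N 0%N isT isT); have g31 := amgm _ _ (e2 1%N 1%N isT isT).
have := sqn_mulz_le i1 (x 0%N); have := sqn_mulz_le i1 (x 1%N).
have := sqn_mulz_le i2 (x 0%N); have := sqn_mulz_le i2 (x 1%N) => l1 l2 l3 l4.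
have close j : (j < 2)%N -> sqn (x j - ev (x j) o *: k0) <= 27 / 1000.
  move=> j2; apply: le_trans (near_constant _ i12) _.
  by clear -g00 g11 g20 g31 l1 l2 l3 l4 x1 y12 j2; case: j j2 => [|[|]] // _; lra.
have approx (i j : nat) : (i < 2)%N -> (j < 2)%N ->
    nsq ((if i == j then s else 0) - ev (x j) o * inner (mulz i1 k0) (y1 i)) <= 27 / 1000.
  move=> ilt j2; rewrite -e1 // -ipZl -ipBl.
  have -> : mulz i1 (x j) - ev (x j) o *: mulz i1 k0 = mulz i1 (x j - ev (x j) o *: k0).
    rewrite mulzB; congr (_ - _); apply: ev_ext => w.
    by rewrite evZ !ev_mulz evZ mulrCA.
  apply: le_trans (cauchy_schwarz _ _) _; rewrite -[leRHS]mulr1.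
  apply: ler_pM; rewrite ?sqn_ge0 ?y1le //.
  exact: le_trans (sqn_mulz_le _ _) (close _ j2).
have nsqN (z : C) : nsq (0 - z) = nsq z by rewrite /nsq; case: z => a b /=; ring.
have a01 := approx 0%N 1%N isT isT; have a10 := approx 1%N 0%N isT isT.
apply: (rank_one_far_from_diag (approx 0%N 0%N isT isT) (approx 1%N 1%N isT isT)).
  by rewrite -nsqN; exact: a10.
by rewrite -nsqN; exact: a01.
Qed.

End DimensionAtLeastTwo.

Theorem corollary5p4 (R : realType) (d : nat) (H2d : drury_arveson R d) :
  ~ property_A11 (mx_algebra 6 (multiplier_algebra H2d)).
Proof.
case: d H2d => [|[|d]] H2d; [exact: not_property_A11_dim0 | exact: not_property_A11_dim1 |].
exact: (@not_property_A11_dim_ge2 _ _ _ ord0 (lift ord0 ord0)).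
Qed.
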